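(* Let $0<b\le\infty$ and let $f:[0,b)\to\mathbb{R}$ be such that $\log\circ f$ is a Bernstein function on $[0,b)$. Let $g$ be completely monotone on $(0,b)$. Then the function $x\mapsto f(x)^{g(x)/x}$ is logarithmically completely monotone on $(0,b)$.
   Context: A function $f:I\to\mathbb{R}$ on an interval $I\subseteq\mathbb{R}$ is called completely monotone if it has derivatives of all orders and $(-1)^n f^{(n)}(x)\ge 0$ for all $n=0,1,2,\ldots$ and all $x\in I$. A function $f:I\to\mathbb{R}$ is called a Bernstein function if $f\ge 0$ and $f'$ is completely monotone on $I$ (derivatives at an endpoint belonging to $I$ are one-sided). A positive function $f:I\to\mathbb{R}$ is called logarithmically completely monotone if it has derivatives of all orders and $(-1)^n(\log\circ f)^{(n)}(x)\ge 0$ for all $n=1,2,\ldots$ and all $x\in I$. *)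

(* Defs.v *)
From mathcomp Require Import all_boot all_order all_algebra.
From mathcomp Require Import all_classical all_reals all_analysis.

Set Implicit Arguments.
Unset Strict Implicit.
Unset Printing Implicit Defensive.

Import Order.TTheory GRing.Theory Num.Theory.
Import numFieldNormedType.Exports.

Local Open Scope classical_set_scope.
Local Open Scope ring_scope.

(* A function I -> R is represented by a total f : R -> R of which only the
   values on I matter.  Keeping x + h inside I makes the derivative at x
   one-sided when x is an endpoint belonging to I, and gives the library's
   derivative when I is open (derive1_within_open).  The definitions are
   meant for nondegenerate intervals I: then the filter
   within [set h | I (h + x)] 0^' is proper for every x in I. *)
Definition derivable_within (R : realType) (I : set R) (f : R -> R) (x : R) :
    Prop :=
  cvg ((fun h => h^-1 *: (f (h + x) - f x)) @ within [set h | I (h + x)] 0^').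

Definition derive1_within (R : realType) (I : set R) (f : R -> R) (x : R) : R :=
  lim ((fun h => h^-1 *: (f (h + x) - f x)) @ within [set h | I (h + x)] 0^').

Definition derive1n_within (R : realType) (I : set R) (n : nat) (f : R -> R) :
    R -> R :=
  iter n (derive1_within I) f.

Lemma within_translate_open (R : realType) (I : set R) (x : R) :
  open I -> I x -> within [set h : R | I (h + x)] 0^' = 0^'.
Proof.
move=> oI Ix; have Ih : \forall h \near (0 : R)^', I (h + x).
  apply: cvg_within.
  have := @cvgD _ _ _ (nbhs (0 : R)) _ id (cst x) 0 x cvg_id (cvg_cst _).
  by rewrite add0r; apply; exact: open_nbhs_nbhs.
apply/seteqP; split=> A; last exact: cvg_within.
by rewrite /within/= => IA; near=> h; apply: (near IA h) => //; near: h.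
Unshelve. all: by end_near. Qed.

Lemma derivable_within_open (R : realType) (I : set R) (f : R -> R) (x : R) :
  open I -> I x -> derivable_within I f x = derivable f x 1.
Proof.
move=> oI Ix; rewrite /derivable_within within_translate_open// /derivable.
by under [in RHS]eq_fun do rewrite /= [_ *: 1]mulr1.
Qed.

Lemma derive1_within_open (R : realType) (I : set R) (f : R -> R) (x : R) :
  open I -> I x -> derive1_within I f x = (f^`())%classic x.
Proof.
by move=> oI Ix; rewrite /derive1_within within_translate_open// derive1E.
Qed.

Definition smooth_on (R : realType) (I : set R) (f : R -> R) : Prop :=
  forall (n : nat) (x : R), I x -> derivable_within I (derive1n_within I n f) x.

Definition completely_monotone (R : realType) (I : set R) (f : R -> R) : Prop :=
  smooth_on I f /\
  forall (n : nat) (x : R), I x -> 0 <= (-1) ^+ n * derive1n_within I n f x.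

Definition bernstein (R : realType) (I : set R) (f : R -> R) : Prop :=
  [/\ forall x, I x -> 0 <= f x,
      forall x, I x -> derivable_within I f x
    & completely_monotone I (derive1_within I f)].

Definition log_completely_monotone (R : realType) (I : set R) (f : R -> R) :
    Prop :=
  [/\ forall x, I x -> 0 < f x,
      smooth_on I f
    & forall (n : nat) (x : R), (0 < n)%N -> I x ->
        0 <= (-1) ^+ n * derive1n_within I n (@ln R \o f) x].

(* [0, b) and (0, b), where b may be +oo. *)
Definition itvco0 (R : realType) (b : \bar R) : set R :=
  [set x | 0 <= x /\ (x%:E < b)%E].

Definition itvoo0 (R : realType) (b : \bar R) : set R :=
  [set x | 0 < x /\ (x%:E < b)%E].

(* Main.v *)
(* Since ln (f x `^ (g x / x)) = g x * (L x / x) with L = ln o f, and completely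
   monotone functions are closed under products and under expR, it suffices
   that L x / x is completely monotone.  Its n-th derivative is
   (-1)^n n! S_n(x) / x^(n+1), where S_n(x) = sum_(k <= n) (-x)^k L^(k)(x) / k!
   is the Taylor polynomial of L at x, evaluated at 0.  As
   S_n'(x) = (-x)^n L^(n+1)(x) / n! >= 0 and S_n(x) tends to L(0) >= 0 when x
   tends to 0, S_n is nonnegative. *)
Require Import Defs.
From mathcomp Require Import all_boot all_order all_algebra.
From mathcomp Require Import all_classical all_reals all_analysis.
From mathcomp Require Import ring.

Set Implicit Arguments.
Unset Strict Implicit.
Unset Printing Implicit Defensive.

Import Order.TTheory GRing.Theory Num.Theory.
Import numFieldNormedType.Exports.

Local Open Scope classical_set_scope.
Local Open Scope ring_scope.

(** * Complete monotonicity up to a finite order, and its closure properties *)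

Section completely_monotone_up_to.
Context {R : realType}.
Implicit Types (U : set R) (f g : R -> R).

(* [f1] plays the role of [- f'], so that complete monotonicity is a condition
   of nonnegativity only and is stable under products by induction on [n]. *)
Fixpoint cm_upto U n f : Prop :=
  (forall x, U x -> 0 <= f x) /\
  if n is m.+1 then
    exists2 f1, (forall x, U x -> is_derive x 1 f (- f1 x)) & cm_upto U m f1
  else True.

Lemma cm_upto_ge0 U n f x : cm_upto U n f -> U x -> 0 <= f x.
Proof. by case: n => [|n] /= [f0 _]; exact: f0. Qed.

Lemma cm_uptoS U n f : cm_upto U n.+1 f -> cm_upto U n f.
Proof.
elim: n f => [|n IH] f; first by case.
by case=> f0 [f1 df cf1]; split=> //; exists f1 => //; exact: IH.
Qed.

(** Serves to certify complete monotonicity from explicit formulas for the signed derivatives. The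
    index [k] is general because each lowering of the order shifts the sequence by one. *)
Lemma cm_upto_seq U (G : nat -> R -> R) :
  (forall n x, U x -> 0 <= G n x) ->
  (forall n x, U x -> is_derive x 1 (G n) (- G n.+1 x)) ->
  forall n k, cm_upto U n (G k).
Proof.
move=> G0 dG; elim=> [|n IH] k; (split; first exact: G0) => //.
by exists (G k.+1) => // x; exact: dG.
Qed.

Lemma eq_is_derive_open U f g x df : open U -> U x ->
  (forall y, U y -> f y = g y) -> is_derive x 1 f df -> is_derive x 1 g df.
Proof.
move=> oU Ux fg; apply: near_eq_is_derive.
by near=> y; apply: fg; near: y; exact: open_nbhs_nbhs.
Unshelve. all: by end_near. Qed.

Lemma eq_cm_upto U n f g : open U -> (forall x, U x -> f x = g x) ->
  cm_upto U n f -> cm_upto U n g.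
Proof.
move=> oU fg; case: n => [|n] /= [f0 cf];
  (split; first by move=> x Ux; rewrite -fg// f0) => //.
case: cf => f1 df cf1; exists f1 => // x Ux.
by apply: (eq_is_derive_open oU Ux fg); exact: df.
Qed.

Lemma cm_uptoD U n f g :
  cm_upto U n f -> cm_upto U n g -> cm_upto U n (fun x => f x + g x).
Proof.
elim: n f g => [|n IH] f g [f0 cf] [g0 cg];
  (split; first by move=> x Ux; rewrite addr_ge0 ?f0 ?g0) => //.
case: cf cg => f1 df cf1 [g1 dg cg1].
exists (fun x => f1 x + g1 x); last exact: IH.
move=> x Ux; rewrite opprD.
by apply: is_deriveD; [exact: df|exact: dg].
Qed.

(** Minus the derivative of the product is [f * g1 + g * f1], and all four factors have order [n]:
    [f1] and [g1] by definition, [f] and [g] by [cm_uptoS]. *)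
Lemma cm_uptoM U n f g :
  cm_upto U n f -> cm_upto U n g -> cm_upto U n (fun x => f x * g x).
Proof.
elim: n f g => [|n IH] f g cf cg;
  (split; first by move=> x Ux;
    rewrite mulr_ge0 ?(cm_upto_ge0 cf) ?(cm_upto_ge0 cg)) => //.
have [cfn cgn] := (cm_uptoS cf, cm_uptoS cg).
case: cf cg => [f0 [f1 df cf1]] [g0 [g1 dg cg1]].
exists (fun x => f x * g1 x + g x * f1 x).
  move=> x Ux; have := is_deriveM (df x Ux) (dg x Ux).
  by rewrite /GRing.scale/= !mulrN -opprD.
by apply: cm_uptoD; exact: IH.
Qed.

(** Minus the derivative of [expR \o f] is [expR (f x) * f1 x], a product to which the induction
    hypothesis and [cm_uptoM] apply at order [n]. *)
Lemma cm_upto_expR U n f :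
  cm_upto U n f -> cm_upto U n (fun x => expR (f x)).
Proof.
elim: n f => [|n IH] f cf; (split; first by move=> x Ux; exact: expR_ge0) => //.
have cfn := cm_uptoS cf.
case: cf => [_ [f1 df cf1]]; exists (fun x => expR (f x) * f1 x).
  by move=> x Ux; rewrite -mulrN; apply: is_derive1_comp; exact: df.
by apply: cm_uptoM => //; exact: IH.
Qed.

End completely_monotone_up_to.

(** * Derivatives relative to a set compared with ordinary derivatives *)

Section derive_within.
Context {R : realType}.
Implicit Types (U I : set R) (f g : R -> R).

(** All small increments from [x] stay in [U], hence in [I], so the restriction to [I] disappears
    near [0]. This allows an [I] that is not open, such as [0, b). *)
Lemma is_derive_within_sub U I f x : open U -> U `<=` I -> U x ->
  derivable_within I f x -> is_derive x 1 f (derive1_within I f x).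
Proof.
move=> oU UI Ux.
have E : within [set h : R | I (h + x)] 0^' = 0^'.
  have Ih : \forall h \near (0 : R)^', I (h + x).
    have := within_translate_open oU Ux => WU.
    rewrite -WU; near=> h; apply: UI; near: h.
    exact: withinT.
  apply/seteqP; split=> A; last exact: cvg_within.
  by rewrite /within/= => IA; near=> h; apply: (near IA h) => //; near: h.
rewrite /derivable_within /derive1_within E => df; split.
  by rewrite /derivable; under eq_fun do rewrite /= [_ *: 1]mulr1.
by rewrite /derive; under eq_fun do rewrite /= [_ *: 1]mulr1.
Unshelve. all: by end_near. Qed.

Lemma is_derive1_within U f x df : open U -> U x ->
  is_derive x 1 f df -> derivable_within U f x /\ derive1_within U f x = df.
Proof.
move=> oU Ux [fx <-].
by rewrite derivable_within_open// derive1_within_open// derive1E.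
Qed.

(** For [h > 0], [f h] is [f 0] plus [h] times the difference quotient; the quotient converges, so
    the product tends to 0. *)
Lemma derivable_within_right_continuous I f : (\forall h \near 0^'+, I h) ->
  derivable_within I f 0 -> f x @[x --> 0^'+] --> f 0.
Proof.
move=> I0 df.
have sub : (0 : R)^'+ `=>` within [set h : R | I (h + 0)] 0^'.
  move=> A; rewrite /within/= => WA.
  have WA' : \forall h \near (0 : R)^'+, I (h + 0) -> A h.
    by move: WA; apply: within_subset => h /gt_eqF/negbT.
  near=> h; apply: (near WA' h) => //; rewrite addr0; near: h; exact: I0.
have q := cvg_trans (cvg_app _ sub) df.
have : h * (h^-1 *: (f (h + 0) - f 0)) + f 0 @[h --> 0^'+] -->
   0 * lim ((fun h => h^-1 *: (f (h + 0) - f 0)) @ within [set h | I (h + 0)] 0^')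
   + f 0.
  apply: cvgD; last exact: cvg_cst.
  apply: cvgM => //; exact: (@cvg_at_right_filter _ _ id).
rewrite mul0r add0r; apply: cvg_trans; apply: near_eq_cvg.
near=> h; have h0 : h != 0 by rewrite gt_eqF.
by rewrite addr0 /GRing.scale/= mulrA divff// mul1r subrK.
Unshelve. all: by end_near. Qed.

Lemma completely_monotone_upto U f : open U ->
  completely_monotone U f -> forall n, cm_upto U n f.
Proof.
move=> oU [sf cf] n.
pose G k x := (-1) ^+ k * derive1n_within U k f x.
have : cm_upto U n (G 0).
  apply: cm_upto_seq => [k x Ux|k x Ux]; first exact: cf.
  have := is_derive_within_sub oU (@subset_refl _ U) Ux (sf k x Ux).
  move=> /(is_deriveZ ((-1) ^+ k)).
  by rewrite /G exprS mulN1r mulNr opprK.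
by apply: eq_cm_upto => // x _; rewrite /G mul1r.
Qed.

(** The witness [f1] inside [cm_upto] is determined on [U], where it must be the next signed
    derivative. The order [m] is general because passing from [n] to [n.+1] consumes one order. *)
Lemma cm_upto_derive1n_within U f : open U -> (forall n, cm_upto U n f) ->
  forall n m, cm_upto U m (fun x => (-1) ^+ n * derive1n_within U n f x).
Proof.
move=> oU cf; elim=> [|n IH] m.
  by apply: eq_cm_upto (cf m) => // x _; rewrite mul1r.
case: (IH m.+1) => _ [f1 df cf1]; apply: eq_cm_upto cf1 => // x Ux.
(* A second factor [(-1) ^+ n] cancels the first and recovers the unsigned derivative. *)
have d := is_deriveZ ((-1) ^+ n) (df x Ux).
have /(is_derive1_within oU Ux) [_ e] : is_derive x 1 (derive1n_within U n f)
    ((-1) ^+ n *: - f1 x).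
  apply: (eq_is_derive_open oU Ux _ d) => y _ /=.
  by rewrite /GRing.scale/= mulrA -exprMn mulrNN mulr1 expr1n mul1r.
rewrite /= e exprS /GRing.scale/= mulrN mulrN mulN1r mulNr opprK mulrA.
by rewrite -exprMn mulrNN mulr1 expr1n mul1r.
Qed.

Lemma upto_completely_monotone U f : open U ->
  (forall n, cm_upto U n f) -> completely_monotone U f.
Proof.
move=> oU /(cm_upto_derive1n_within oU) cf; split=> n x Ux.
  case: (cf n 1) => _ [f1 df _].
  have d := is_deriveZ ((-1) ^+ n) (df x Ux).
  have /(is_derive1_within oU Ux) [] // :
      is_derive x 1 (derive1n_within U n f) ((-1) ^+ n *: - f1 x).
  apply: (eq_is_derive_open oU Ux _ d) => y _ /=.
  by rewrite /GRing.scale/= mulrA -exprMn mulrNN mulr1 expr1n mul1r.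
exact: cm_upto_ge0 (cf n 0) Ux.
Qed.

End derive_within.

Lemma open_itvoo0 (R : realType) (b : \bar R) : open (itvoo0 b).
Proof.
have -> : itvoo0 b = [set x | 0 < x] `&` [set x | (x%:E < b)%E] by [].
apply: openI; first exact: open_gt.
case: b => [r| |].
- by under eq_set do rewrite lte_fin; exact: open_lt.
- rewrite (_ : [set x | _] = setT); first exact: openT.
  by apply/seteqP; split=> x //= _; exact: ltry.
- rewrite (_ : [set x | _] = set0); first exact: open0.
  by apply/seteqP; split=> x.
Qed.

(** * Sign of the Taylor polynomials, and complete monotonicity of [F 0 x / x] *)

Section taylor_at_0.
Context {R : realType}.
Variable (F : nat -> R -> R).

(* [F k] stands for the [k]-th derivative of [F 0]. *)
Definition taylor0 n x : R := \sum_(k < n.+1) (- x) ^+ k / k`!%:R * F k x.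

Lemma taylor0S n x :
  taylor0 n.+1 x = taylor0 n x + (- x) ^+ n.+1 / n.+1`!%:R * F n.+1 x.
Proof. by rewrite /taylor0 big_ord_recr. Qed.

(** The sum telescopes: differentiating the power in the term of index [n.+1] cancels the derivative
    of [taylor0 n], and only the part that differentiates [F n.+1] remains. *)
Lemma is_derive_taylor0 n (x : R) :
  (forall k, is_derive x 1 (F k) (F k.+1 x)) ->
  is_derive x 1 (taylor0 n) ((- x) ^+ n / n`!%:R * F n.+1 x).
Proof.
move=> dF; elim: n => [|n IH].
  rewrite (_ : taylor0 0 = F 0); last first.
    by apply/funext => y; rewrite /taylor0 big_ord1 fact0 expr0 divr1 mul1r.
  by rewrite fact0 expr0 divr1 mul1r.
have -> : taylor0 n.+1 = taylor0 n +
    (n.+1`!%:R^-1 *: ((- id : R -> R) ^+ n.+1)) * F n.+1.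
  apply/funext => y; rewrite taylor0S /=; congr (_ + _ * _).
  by rewrite fctE /GRing.scale/= mulrC fctE.
have dX := is_deriveX n.+1 (is_deriveN (is_derive_id x (1 : R))).
have := is_deriveD IH (is_deriveM (is_deriveZ n.+1`!%:R^-1 dX) (dF n.+1)).
move/is_derive_eq; apply.
rewrite !fctE /GRing.scale/= factS natrM.
have n0 : (n`!%:R : R) != 0 by rewrite pnatr_eq0 -lt0n fact_gt0.
have n1 : (n.+1%:R : R) != 0 by rewrite pnatr_eq0.
by rewrite exprS /GRing.scale/=; field; rewrite n0 addrC natr1 n1.
Qed.

Lemma taylor0_right_continuous n :
  (forall k, F k x @[x --> 0^'+] --> F k 0) ->
  taylor0 n x @[x --> 0^'+] --> taylor0 n 0.
Proof.
move=> F0; apply: cvg_big => [|k _]; first exact: add_continuous.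
apply: cvgM => //; apply: cvgM; last exact: cvg_cst.
apply: cvg_at_right_filter.
apply: (@continuous_comp _ _ _ (-%R : R -> R) (fun y => y ^+ k)).
  exact: opp_continuous.
exact: exprn_continuous.
Qed.

Variable b : \bar R.
Hypothesis dF : forall k x, itvoo0 b x -> is_derive x 1 (F k) (F k.+1 x).
Hypothesis F0 : forall k, F k x @[x --> 0^'+] --> F k 0.
Hypothesis F00 : 0 <= F 0 0.
Hypothesis Fsg : forall k x, itvoo0 b x -> 0 <= (-1) ^+ k * F k.+1 x.

Lemma taylor0_ge0 n x : itvoo0 b x -> 0 <= taylor0 n x.
Proof.
move=> [x0 xb].
have I (y : R) : 0 < y -> y <= x -> itvoo0 b y.
  by move=> y0 yx; split=> //; apply: le_lt_trans xb; rewrite lee_fin.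
have dS y (y0 : 0 < y) (yx : y <= x) :=
  is_derive_taylor0 n (fun k => dF k (I _ y0 yx)).
have cS y : 0 < y -> y <= x -> {for y, continuous (taylor0 n)}.
  move=> y0 yx; apply/differentiable_continuous/derivable1_diffP.
  by have [] := dS y y0 yx.
have S0 : taylor0 n 0 = F 0 0.
  rewrite /taylor0 big_ord_recl/= big1 ?addr0 => [|k _].
    by rewrite fact0 expr0 divr1 mul1r.
  by rewrite oppr0 expr0n/= !mul0r.
apply: le_trans F00 _; rewrite -S0.
(* Monotonicity on the closed interval from 0 to [x] needs the derivative only in the interior; at
   0, right continuity suffices. *)
apply: (@ger0_derive1_le_cc _ (taylor0 n) 0 x) => //.
- move=> y; rewrite in_itv/= => /andP[y0 /ltW yx].
  by have [] := dS y y0 yx.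
- move=> y; rewrite in_itv/= => /andP[y0 /ltW yx].
  have [_] := dS y y0 yx; rewrite -derive1E => ->.
  (* The sign of [(- y) ^+ n] is moved onto [F n.+1 y], where [Fsg] applies. *)
  have -> : (- y) ^+ n / n`!%:R * F n.+1 y =
      y ^+ n / n`!%:R * ((-1) ^+ n * F n.+1 y).
    by rewrite (exprNn y); ring.
  apply: mulr_ge0; last by apply: Fsg; exact: I.
  by rewrite divr_ge0 ?exprn_ge0 ?ler0n// ltW.
- apply/continuous_within_itvP => //; split.
  + by move=> y; rewrite in_itv/= => /andP[y0 /ltW yx]; exact: cS.
  + exact: taylor0_right_continuous.
  + by apply: cvg_at_left_filter; exact: cS.
- by rewrite in_itv/= lexx ltW.
- by rewrite in_itv/= lexx ltW.
- exact: ltW.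
Qed.

Lemma cm_upto_divx n : cm_upto (itvoo0 b) n (fun x => F 0 x / x).
Proof.
(* The [k]-th derivative of [F 0 x / x] times [(-1) ^+ k]. On differentiating [G k], the derivative
   of [taylor0 k] supplies exactly the term that turns [taylor0 k] into [taylor0 k.+1]. *)
pose G k x := k`!%:R * taylor0 k x * x^-1 ^+ k.+1.
have : cm_upto (itvoo0 b) n (G 0).
  apply: cm_upto_seq => [k x Ux|k x Ux].
    have /ltW x0 : 0 < x by case: Ux.
    by rewrite /G !mulr_ge0 ?exprn_ge0 ?invr_ge0 ?ler0n// taylor0_ge0.
  have x0 : x != 0 by case: Ux => /gt_eqF/negbT.
  have dS := is_derive_taylor0 k (fun k => dF k Ux).
  have dV := @is_deriveV _ id x 1 1 x0 (is_derive_id _ _).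
  have := is_deriveM (is_deriveZ (k`!%:R) dS) (is_deriveX k.+1 dV).
  have -> : k`!%:R *: taylor0 k * (fun y => (id y)^-1) ^+ k.+1 = G k.
    by apply/funext => y; rewrite /G !fctE.
  move/is_derive_eq; apply.
  rewrite /G !fctE taylor0S /GRing.scale/= factS natrM.
  have n0 : (k`!%:R : R) != 0 by rewrite pnatr_eq0 -lt0n fact_gt0.
  have n1 : (k.+1%:R : R) != 0 by rewrite pnatr_eq0.
  rewrite /GRing.scale/= !exprVn !exprS expr0; field.
  by rewrite n0 addrC natr1 n1 x0 ?expf_neq0.
apply: eq_cm_upto => [|x _]; first exact: open_itvoo0.
by rewrite /G /taylor0 big_ord1 fact0 !expr0 expr1 divr1 !mul1r.
Qed.

End taylor_at_0.

(** * Application to Bernstein functions on [0, b) and to the power *)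

Lemma near_right0_itvco0 (R : realType) (b : \bar R) :
  (0 < b)%E -> \forall x \near 0^'+, itvco0 b x.
Proof.
case: b => [r| |] // b0; near=> x; split.
- by near: x; exact: nbhs_right_ge.
- by rewrite lte_fin; near: x; exact: nbhs_right_lt.
- by near: x; exact: nbhs_right_ge.
- by rewrite ltry.
Unshelve. all: by end_near. Qed.

Lemma cm_upto_bernstein_divx (R : realType) (b : \bar R) (L : R -> R) n :
  (0 < b)%E -> bernstein (itvco0 b) L ->
  cm_upto (itvoo0 b) n (fun x => L x / x).
Proof.
move=> b0 [L0 dL [sL cL]].
have sub : itvoo0 b `<=` itvco0 b by move=> x [/ltW].
have I0 : itvco0 b (0 : R) by split.
have dF k x : itvco0 b x ->
    derivable_within (itvco0 b) (derive1n_within (itvco0 b) k L) x.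
  case: k => [|k]; first exact: dL.
  by rewrite /derive1n_within iterSr; exact: sL.
(* The derivatives are taken relative to [0, b): they are ordinary ones on (0, b), while at 0 they
   are one-sided and yield the right limits. *)
apply: (@cm_upto_divx _ (fun k => derive1n_within (itvco0 b) k L)).
- move=> k x Ux; have := dF k x (sub _ Ux).
  exact: is_derive_within_sub (@open_itvoo0 R b) sub Ux.
- move=> k; apply: derivable_within_right_continuous (dF _ _ I0).
  exact: near_right0_itvco0.
- exact: L0.
- move=> k x /sub Ux; have := cL k x Ux.
  by rewrite /derive1n_within iterSr.
Qed.

Theorem theorem2p11 (R : realType) (b : \bar R) (f g : R -> R)
    (b_gt0 : (0 < b)%E)
    (f_gt0 : forall x : R, itvco0 b x -> 0 < f x)
    (lnf_bernstein : bernstein (itvco0 b) (@ln R \o f))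
    (g_cm : completely_monotone (itvoo0 b) g) :
  log_completely_monotone (itvoo0 b) (fun x : R => f x `^ (g x / x)).
Proof.
have oU := @open_itvoo0 R b.
have f0 x : itvoo0 b x -> 0 < f x by move=> [/ltW x0 xb]; exact: f_gt0.
pose phi x := g x * (ln (f x) / x).
have cphi n : cm_upto (itvoo0 b) n phi.
  apply: cm_uptoM; first exact: completely_monotone_upto.
  exact: cm_upto_bernstein_divx lnf_bernstein.
(* This holds at every real [x], as [ln_powR] asks for no positivity, so iterated derivatives can be
   rewritten directly. *)
have lnE : @ln R \o (fun x => f x `^ (g x / x)) = phi.
  by apply/funext => x; rewrite /= ln_powR /phi mulrAC mulrA.
split.
- by move=> x /f0; exact: powR_gt0.
(* Smoothness is read off from the complete monotonicity of [expR \o phi], which agrees with the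
   power on (0, b) since [f] is positive there. *)
- have [] // : completely_monotone (itvoo0 b) (fun x => f x `^ (g x / x)).
  apply: upto_completely_monotone => // n.
  apply: eq_cm_upto (cm_upto_expR (cphi n)) => // x Ux.
  by rewrite -lnE /= lnK// posrE powR_gt0// f0.
- move=> n x _ Ux; rewrite lnE.
  by have [_] := upto_completely_monotone oU cphi; exact.
Qed.
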